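(* There exist absolute constants $C,c>0$ such that for all $\varepsilon\in(0,1/2)$ and $\delta\in(0,1/10)$ there is a positive integer $t\le C\log^5(1/\delta)/\varepsilon^6$ with the following property: for every $n\ge c\ln^{10}(1/\delta)/\varepsilon^{10}$ for which $t$-regular graphs on $n$ nodes exist, there is an (unrestricted) $(\varepsilon,\delta)$-LNDP algorithm $\mathcal{A}$ on $n$-node graphs with outputs in $\{\text{starpartite},\text{regular}\}$ such that \[ \Pr_{G\sim\mathcal{G}^{star}_t}[\mathcal{A}(G)=\text{starpartite}]\ge\frac23\quad\text{and}\quad\Pr_{G\sim\mathcal{G}^{reg}_t}[\mathcal{A}(G)=\text{regular}]\ge\frac23. \]
   Context: Graphs are simple and undirected on node set $[n]$; $N_i^G$ is the neighborhood of node $i$. For $T\subseteq[n]$, the starpartite graph $S_T$ has edge set $\{\{i,j\}:i\in T,j\in[n],i\ne j\}$; it is $t$-starpartite if $|T|=t$. $\mathcal{G}^{reg}_t$ is the uniform distribution over $t$-regular graphs on $[n]$, and $\mathcal{G}^{star}_t$ the uniform distribution over $t$-starpartite graphs on $[n]$. Two graphs on $[n]$ are node neighbors if they differ only in edges incident to a single node. Random variables $R_1,R_2$ are $(\varepsilon,\delta)$-indistinguishable if for every event $Y$, $\Pr[R_1\in Y]\le e^\varepsilon\Pr[R_2\in Y]+\delta$ and symmetrically. An algorithm $\mathcal{A}$ on $n$-node graphs is (noninteractive) $(\varepsilon,\delta)$-LNDP if there exist a distribution over public random strings $\rho$, local randomizers $\mathcal{R}_{1,\rho},\dots,\mathcal{R}_{n,\rho}$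 (with independent internal randomness), and a postprocessing $\mathcal{P}$ with $\mathcal{A}(G)=\mathcal{P}(\mathcal{R}_{1,\rho}(N_1^G),\dots,\mathcal{R}_{n,\rho}(N_n^G))$, such that for every fixed $\rho$ and every node-neighboring $G,G'$ the randomizer output vectors on $G$ and $G'$ are $(\varepsilon,\delta)$-indistinguishable. ''Unrestricted'' means randomizers may depend on the whole set $N_i^G$. *)

(* Defs.v *)
From HB Require Import structures.
From mathcomp Require Import all_boot all_order all_algebra.
From mathcomp Require Import reals Rstruct.
From mathcomp.analysis Require Import sequences exp.
Set Implicit Arguments. Unset Strict Implicit. Unset Printing Implicit Defensive.
Import Order.TTheory GRing.Theory Num.Theory.
Local Open Scope ring_scope.
Notation R := Rdefinitions.R.

Inductive answer := Starpartite | Regular.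
Definition answer_eqb (a b : answer) : bool :=
  match a, b with
  | Starpartite, Starpartite | Regular, Regular => true
  | _, _ => false end.
Lemma answer_eqP : Equality.axiom answer_eqb.
Proof. by case; case; constructor. Qed.
HB.instance Definition _ := hasDecEq.Build answer answer_eqP.

Section Graphs.
Variable n : nat.

Definition graph := {set {set 'I_n}}.
Definition is_graph (G : graph) : bool := [forall e in G, #|e| == 2].
Definition nbhd (G : graph) (i : 'I_n) : {set 'I_n} := [set j | [set i; j] \in G].
Definition node_neighbors (G G' : graph) : Prop :=
  exists v : 'I_n, forall e : {set 'I_n}, v \notin e -> (e \in G) = (e \in G').
Definition starpartite (T : {set 'I_n}) : graph :=
  [set e : {set 'I_n} | [exists i in T, exists j : 'I_n, (j != i) && (e == [set i; j])]].
Definition star_graphs (t : nat) : {set graph} :=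
  [set starpartite T | T in [set T : {set 'I_n} | #|T| == t]].
Definition regular_graphs (t : nat) : {set graph} :=
  [set G : graph | is_graph G && [forall i, #|nbhd G i| == t]].

Definition unif_avg (S : {set graph}) (f : graph -> R) : R :=
  (#|S|%:R)^-1 * \sum_(G in S) f G.

Definition is_pmf (T : finType) (p : T -> R) : Prop :=
  (forall x, 0 <= p x) /\ \sum_x p x = 1.

Definition indist (T : finType) (p q : T -> R) (eps delta : R) : Prop :=
  forall Y : {set T},
    \sum_(y in Y) p y <= expR eps * \sum_(y in Y) q y + delta /\
    \sum_(y in Y) q y <= expR eps * \sum_(y in Y) p y + delta.

(* Joint pmf of the randomizer outputs (R_1(N_1^G),...,R_n(N_n^G)) for a fixed
   public string: the randomizers use independent internal randomness, so the
   joint pmf is the product. [Rz i N] is the output pmf of R_i on input N. *)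
Definition out_pmf (O : finType) (Rz : 'I_n -> {set 'I_n} -> O -> R) (G : graph)
  (y : {ffun 'I_n -> O}) : R := \prod_i Rz i (nbhd G i) (y i).

(* Noninteractive (eps,delta)-LNDP algorithm: public randomness with pmf mu on Pub,
   local randomizers Rz rho i (unrestricted: depending on the whole N_i^G),
   privacy for every fixed rho and every node-neighbouring pair of graphs. *)
Definition is_LNDP (Pub O : finType) (mu : Pub -> R)
  (Rz : Pub -> 'I_n -> {set 'I_n} -> O -> R) (eps delta : R) : Prop :=
  [/\ is_pmf mu,
      (forall rho i N, is_pmf (Rz rho i N)) &
      forall rho (G G' : graph), is_graph G -> is_graph G' -> node_neighbors G G' ->
        indist (out_pmf (Rz rho) G) (out_pmf (Rz rho) G') eps delta].

Definition alg_prob (Pub O : finType) (mu : Pub -> R)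
  (Rz : Pub -> 'I_n -> {set 'I_n} -> O -> R) (Post : {ffun 'I_n -> O} -> answer)
  (G : graph) (a : answer) : R :=
  \sum_rho mu rho * \sum_(y : {ffun 'I_n -> O} | Post y == a) out_pmf (Rz rho) G y.

End Graphs.

(* Main.v *)
(** The public randomness is a uniformly random set [H] of nodes, i.e. a random
    sign for every node, and node [i] computes the sum of the signs over its
    neighbourhood, rescaled by [a] and clipped to the interval from -1 to 1. It
    publishes one bit whose bias is this value times [g = 10 / sqrt n].

    Rewiring a node [v] moves the other biases by at most [g / a] and that of [v]
    by at most [2 g], so the order-[m] moment of the likelihood ratio, with [m] of
    order [ln (1 / delta) / eps], bounds the privacy loss as soon as [a] and
    [sqrt n] are large multiples of [m].

    In a starpartite graph almost all nodes share the neighbourhood [T], and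
    [#|T| = 400 a ^ 2] makes the sign sum of [T] at least [a] in absolute value
    with probability 9/10, by the bound on the central binomial coefficient; then
    the sum of the bits is off by about [g n = 10 sqrt n], well above its standard
    deviation [sqrt n]. In a [t]-regular graph nodes with disjoint neighbourhoods
    have uncorrelated biases (flip the signs on one neighbourhood), and each node
    meets at most [t ^ 2] others, so the mean of the sum of the bits has variance
    at most [100 t ^ 2], which is small compared to [n]. *)
Require Import Defs.
From HB Require Import structures.
From mathcomp Require Import all_boot all_order all_algebra.
From mathcomp Require Import reals Rstruct.
From mathcomp.analysis Require Import sequences exp.
From mathcomp Require Import ring lra zify.
Set Implicit Arguments. Unset Strict Implicit. Unset Printing Implicit Defensive.
Import Order.TTheory GRing.Theory Num.Theory.
Local Open Scope ring_scope.

(** * Product distributions *)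

Section ProductDistributions.
Variables (I O : finType).
Implicit Types (p q : I -> O -> R) (y : {ffun I -> O}).

Lemma sum_ffun_prod (f : I -> O -> R) :
  \sum_(y : {ffun I -> O}) \prod_i f i (y i) = \prod_i \sum_o f i o.
Proof. by rewrite bigA_distr_bigA. Qed.

Lemma prod_pmf p :
  (forall i, is_pmf (p i)) -> is_pmf (fun y : {ffun I -> O} => \prod_i p i (y i)).
Proof.
move=> hp; split=> [y|]; first by apply: prodr_ge0 => i _; exact: (hp i).1.
by rewrite sum_ffun_prod big1 // => i _; exact: (hp i).2.
Qed.

(** Expanding the square gives one term per pair of coordinates. By independence an off-diagonal
    term contains a factor of mean zero, so only the diagonal survives. *)
Lemma centered_second_moment p (z : I -> O -> R) :
  (forall i, is_pmf (p i)) -> (forall i, \sum_o p i o * z i o = 0) ->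
  \sum_(y : {ffun I -> O}) (\prod_i p i (y i)) * (\sum_i z i (y i)) ^+ 2 =
  \sum_i \sum_o p i o * z i o ^+ 2.
Proof.
move=> hp hz.
(* Padding with factors 1 away from [i] and [k] turns each pair term into a full product, which the
   expectation factors. *)
have pairE i k : \sum_(y : {ffun I -> O}) (\prod_j p j (y j)) * (z i (y i) * z k (y k)) =
    \prod_j \sum_o p j o * ((if j == i then z i o else 1) * (if j == k then z k o else 1)).
  rewrite -sum_ffun_prod; apply: eq_bigr => y _.
  rewrite 2!big_split /= -!big_mkcond /=; congr (_ * (_ * _)).
    by rewrite big_pred1_eq.
  by rewrite big_pred1_eq.
transitivity (\sum_i \sum_k \sum_(y : {ffun I -> O})
    (\prod_j p j (y j)) * (z i (y i) * z k (y k))).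
  rewrite (eq_bigr (fun i => \sum_(y : {ffun I -> O}) \sum_k
    (\prod_j p j (y j)) * (z i (y i) * z k (y k)))); last by move=> i _; rewrite exchange_big.
  rewrite exchange_big /=; apply: eq_bigr => y _.
  rewrite expr2 mulr_suml mulr_sumr; apply: eq_bigr => i _.
  by rewrite mulr_sumr mulr_sumr.
apply: eq_bigr => i _; rewrite (bigD1 i) //= [X in _ + X]big1 => [|k ki].
  rewrite addr0 pairE (bigD1 i) //= eqxx [X in _ * X]big1 ?mulr1 => [|j ji].
    by apply: eq_bigr => o _; rewrite expr2.
  by rewrite (negPf ji) -[RHS](hp j).2; apply: eq_bigr => o _; rewrite !mulr1.
rewrite pairE (bigD1 i) //= eqxx eq_sym (negPf ki).
by rewrite (eq_bigr (fun o => p i o * z i o)) ?hz ?mul0r // => o _; rewrite mulr1.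
Qed.

End ProductDistributions.

(* Markov's inequality for the [m]-th power of the likelihood ratio: outside of
   the event [p <= e^eps q] this power exceeds [e^(m eps)]. *)
Lemma renyi_indist (T : finType) (p q : T -> R) (m : nat) (eps delta M : R) :
  (forall x, 0 <= p x) -> (forall x, 0 < q x) ->
  \sum_x p x * (p x / q x) ^+ m <= M -> expR (- (m%:R * eps)) * M <= delta ->
  forall Y : {set T}, \sum_(y in Y) p y <= expR eps * \sum_(y in Y) q y + delta.
Proof.
move=> p0 q0 hM hd Y.
have t0 x : 0 <= p x * (p x / q x) ^+ m by rewrite mulr_ge0 ?exprn_ge0 ?divr_ge0 // ltW.
have pw x : p x <= expR eps * q x + expR (- (m%:R * eps)) * (p x * (p x / q x) ^+ m).
  have [le_pq|lt_qp] := leP (p x) (expR eps * q x).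
    by apply: (le_trans le_pq); rewrite lerDl mulr_ge0 // expR_ge0.
  have r1 : expR (m%:R * eps) <= (p x / q x) ^+ m.
    rewrite mulrC expRM_natr lerXn2r ?nnegrE ?expR_ge0 ?divr_ge0 ?(ltW (q0 x)) //.
    by rewrite ler_pdivlMr // ltW.
  apply: ler_wpDl; first by rewrite mulr_ge0 ?expR_ge0 // ltW.
  rewrite mulrCA ler_peMr //; apply: (@le_trans _ _ (expR (- (m%:R * eps)) * expR (m%:R * eps))).
    by rewrite -expRD addNr expR0.
  by rewrite ler_wpM2l // expR_ge0.
apply: (@le_trans _ _ (\sum_(y in Y) (expR eps * q y +
    expR (- (m%:R * eps)) * (p y * (p y / q y) ^+ m)))).
  by apply: ler_sum => y _.
rewrite big_split /= -!mulr_sumr lerD2l; apply: le_trans hd.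
rewrite ler_wpM2l ?expR_ge0 //; apply: le_trans hM.
by rewrite [leRHS](bigID (mem Y)) /= lerDl sumr_ge0.
Qed.

(** * Biased bits *)

Section BiasedBits.

Definition sgb (b : bool) : R := if b then 1 else -1.
Definition bit_pmf (x : R) (b : bool) : R := (1 + sgb b * x) / 2.

Lemma sum_bool (f : bool -> R) : \sum_b f b = f true + f false.
Proof. by rewrite big_bool. Qed.

Lemma is_pmf_bit x : `|x| <= 1 -> is_pmf (bit_pmf x).
Proof.
rewrite ler_norml => /andP[x1 x2]; split=> [b|]; last by rewrite sum_bool /bit_pmf /sgb; lra.
by case: b; rewrite /bit_pmf /sgb; lra.
Qed.

(** Bernoulli's inequality reversed at second order. In the induction the cubic term [k ^ 2 * u ^ 3]
    is at most [k * u ^ 2], because [k * u <= 1]. *)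
Lemma exprD1_le (u : R) (k : nat) :
  -1 <= u -> k%:R * `|u| <= 1 -> (1 + u) ^+ k <= 1 + k%:R * u + (k%:R * u) ^+ 2.
Proof.
move=> u1; elim: k => [|k IH]; first by move=> _; rewrite expr0 !mul0r expr0n /=; lra.
rewrite -natr1 => hk; have u0 : 0 <= `|u| by [].
have k0 : (0 : R) <= k%:R by [].
rewrite exprSr; apply: (le_trans (ler_wpM2r _ (IH _))); [lra|nra|].
have ku : k%:R * u <= 1 by have := ler_norm u; nra.
have : (k%:R * u ^+ 2) * (k%:R * u) <= (k%:R * u ^+ 2) * 1 by rewrite ler_wpM2l // mulr_ge0 // sqr_ge0.
have := sqr_ge0 u; rewrite !expr2 => h1 h2; nra.
Qed.

(** Write the likelihood ratio as [1 + u]. The left side is the mean of [(1 + u) ^ m.+1] under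
    [bit_pmf x'], where [u] has mean zero, so [exprD1_le] leaves only a term quadratic in
    [x - x']. *)
Lemma bit_renyi (x x' : R) (m : nat) :
  `|x| <= 1 -> `|x'| <= 1 / 2 -> 2 * m.+1%:R * `|x - x'| <= 1 ->
  \sum_b bit_pmf x b * (bit_pmf x b / bit_pmf x' b) ^+ m <=
    expR (2 * m.+1%:R ^+ 2 * (x - x') ^+ 2).
Proof.
rewrite !ler_norml => /andP[x1 x2] /andP[y1 y2] hk.
pose u b := sgb b * (x - x') / (1 + sgb b * x').
have den b : 1 / 2 <= 1 + sgb b * x' by case: b; rewrite /sgb; lra.
have den0 b : 0 < 1 + sgb b * x' by have := den b; lra.
have sg1 b : `|sgb b| = 1 by case: b; rewrite /sgb ?normrN normr1.
have uE b : bit_pmf x b / bit_pmf x' b = 1 + u b.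
  by rewrite /bit_pmf /u; field; rewrite gt_eqF.
have pE b : bit_pmf x b = bit_pmf x' b * (1 + u b).
  by rewrite -uE mulrC divfK // gt_eqF // /bit_pmf divr_gt0.
have u_abs b : `|u b| <= 2 * `|x - x'|.
  rewrite /u !normrM sg1 mul1r normfV (gtr0_norm (den0 b)) ler_pdivrMr //.
  by have := den b; have : 0 <= `|x - x'| by []; nra.
have u_ge b : -1 <= u b.
  rewrite /u ler_pdivlMr // mulN1r.
  by case: b; rewrite /sgb; lra.
have uk b : m.+1%:R * `|u b| <= 1.
  apply: le_trans hk; rewrite mulrAC -[leRHS]mulrC ler_wpM2l //.
apply: (@le_trans _ _ (\sum_b bit_pmf x' b * (1 + m.+1%:R * u b + (m.+1%:R * u b) ^+ 2))).
  apply: ler_sum => b _; rewrite uE pE -mulrA -exprS ler_wpM2l ?exprD1_le //.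
  by rewrite /bit_pmf divr_ge0 // ltW.
apply: le_trans (expR_ge1Dx _).
have e1 b : bit_pmf x' b * u b = sgb b * (x - x') / 2.
  by rewrite /bit_pmf /u; field; rewrite gt_eqF.
(* Since [1 + sgb b * x' >= 1 / 2], each of the two bits contributes at most [(x - x') ^ 2]; this is
   the factor 2 in the exponent. *)
have e2 b : bit_pmf x' b * u b ^+ 2 <= (x - x') ^+ 2.
  rewrite expr2 mulrA e1 /u.
  have -> : sgb b * (x - x') / 2 * (sgb b * (x - x') / (1 + sgb b * x')) =
     (x - x') ^+ 2 / (2 * (1 + sgb b * x')).
    have sg2 : sgb b * sgb b = 1 by case: b; rewrite /sgb ?mulrNN mulr1.
    transitivity (sgb b * sgb b * ((x - x') ^+ 2 / (2 * (1 + sgb b * x')))).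
      by field; rewrite gt_eqF.
    by rewrite sg2 mul1r.
  rewrite ler_pdivrMr ?mulr_gt0 // ler_peMr ?sqr_ge0 //; have := den b; lra.
have -> : \sum_b bit_pmf x' b * (1 + m.+1%:R * u b + (m.+1%:R * u b) ^+ 2) =
  \sum_b bit_pmf x' b + m.+1%:R * (\sum_b bit_pmf x' b * u b) +
   m.+1%:R ^+ 2 * (\sum_b bit_pmf x' b * u b ^+ 2) by rewrite !sum_bool; ring.
have hp : is_pmf (bit_pmf x') by apply: is_pmf_bit; rewrite ler_norml; apply/andP; split; lra.
rewrite hp.2.
have -> : \sum_b bit_pmf x' b * u b = 0.
  by rewrite sum_bool !e1 /sgb; ring.
rewrite mulr0 addr0 lerD2l [2 * _ ^+ _]mulrC -[leRHS]mulrA ler_wpM2l ?sqr_ge0 //.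
by rewrite sum_bool; have := e2 true; have := e2 false; lra.
Qed.

Variable n : nat.
Implicit Types (x : 'I_n -> R) (y : {ffun 'I_n -> bool}).

(** For product distributions the moments of the likelihood ratio multiply, so the exponents of
    [bit_renyi] add up over the nodes. *)
Lemma bits_indist x x' (m : nat) (eps delta : R) :
  (forall i, `|x i| <= 1 / 2) -> (forall i, `|x' i| <= 1 / 2) ->
  (forall i, 2 * m.+1%:R * `|x i - x' i| <= 1) ->
  expR (2 * m.+1%:R ^+ 2 * (\sum_i (x i - x' i) ^+ 2) - m%:R * eps) <= delta ->
  forall Y : {set {ffun 'I_n -> bool}},
  \sum_(y in Y) \prod_i bit_pmf (x i) (y i) <=
    expR eps * \sum_(y in Y) \prod_i bit_pmf (x' i) (y i) + delta.
Proof.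
move=> hx hx' hk hd.
have half1 (z : R) : `|z| <= 1 / 2 -> `|z| <= 1 by move=> h; lra.
apply: (@renyi_indist _ _ _ m _ _ (expR (2 * m.+1%:R ^+ 2 * (\sum_i (x i - x' i) ^+ 2)))).
- by move=> y; apply: prodr_ge0 => i _; apply: (is_pmf_bit (half1 _ (hx i))).1.
- move=> y; apply: prodr_gt0 => i _; rewrite /bit_pmf divr_gt0 //.
  by move: (hx' i); rewrite ler_norml => /andP[]; case: (y i); rewrite /sgb; lra.
- rewrite (eq_bigr (fun y : {ffun 'I_n -> bool} => \prod_i (bit_pmf (x i) (y i) *
      (bit_pmf (x i) (y i) / bit_pmf (x' i) (y i)) ^+ m))); last first.
    by move=> y _; rewrite -prodfV -big_split /= -prodrXl -big_split.
  rewrite (sum_ffun_prod (fun i b => bit_pmf (x i) b * (bit_pmf (x i) b / bit_pmf (x' i) b) ^+ m)).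
  rewrite mulr_sumr expR_sum; apply: ler_prod => i _; apply/andP; split.
    apply: sumr_ge0 => b _; have p1 := (is_pmf_bit (half1 _ (hx i))).1 b.
    have p2 := (is_pmf_bit (half1 _ (hx' i))).1 b.
    by rewrite mulr_ge0 // exprn_ge0 // divr_ge0.
  by apply: bit_renyi => //; exact: half1.
- by rewrite -expRD addrC.
Qed.

(** Chebyshev's inequality with an offset: the hypothesis bounds the indicator of [P] by a quadratic
    in the deviation, and each bit has variance [1 - x i ^ 2 <= 1]. The term [beta] absorbs a
    nonzero mean. *)
Lemma bits_tail x (P : pred {ffun 'I_n -> bool}) (alpha beta : R) :
  (forall i, `|x i| <= 1) -> 0 <= alpha -> 0 <= beta ->
  (forall y, P y -> 1 <= alpha * (\sum_i sgb (y i) - \sum_i x i) ^+ 2 + beta) ->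
  \sum_(y : {ffun 'I_n -> bool} | P y) \prod_i bit_pmf (x i) (y i) <= alpha * n%:R + beta.
Proof.
move=> hx a0 b0 hP; set pr := fun y : {ffun 'I_n -> bool} => \prod_i bit_pmf (x i) (y i).
have [pr0 pr1] : is_pmf pr by apply: (prod_pmf (p := fun i => bit_pmf (x i))) => i; exact: is_pmf_bit.
apply: (@le_trans _ _ (\sum_y pr y * (alpha * (\sum_i sgb (y i) - \sum_i x i) ^+ 2 + beta))).
  rewrite big_mkcond /=; apply: ler_sum => y _; case: ifP => Py.
    by rewrite ler_peMr ?pr0 ?hP.
  by rewrite mulr_ge0 ?pr0 // addr_ge0 // mulr_ge0 // sqr_ge0.
under eq_bigr do rewrite mulrDr mulrCA.
rewrite big_split /= -mulr_sumr -mulr_suml pr1 mul1r lerD2r ler_wpM2l //.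
rewrite (eq_bigr (fun y => pr y * (\sum_i (sgb (y i) - x i)) ^+ 2)); last first.
  by move=> y _; rewrite sumrB.
rewrite (centered_second_moment (p := fun i => bit_pmf (x i)) (z := fun i b => sgb b - x i)).
- rewrite -[leRHS]mulr1 -[n in leRHS]card_ord mulr_natl -sumr_const; apply: ler_sum => i _.
  rewrite sum_bool /bit_pmf /sgb; have := sqr_ge0 (x i); rewrite !expr2; nra.
- by move=> i; exact: is_pmf_bit.
- by move=> i; rewrite sum_bool /bit_pmf /sgb; field.
Qed.

End BiasedBits.

(** * Clipping to the interval from -1 to 1 *)

Definition clip (z : R) : R := Num.max (- 1) (Num.min 1 z).

(** This form reduces the later facts on [clip] to linear arithmetic in each case. *)
Lemma clip_cases z :
  [\/ clip z = -1 /\ z <= -1, clip z = z /\ -1 <= z <= 1 | clip z = 1 /\ 1 <= z].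
Proof.
rewrite /clip; have [z1|z1] := leP 1 z; first by constructor 3; split=> //; rewrite max_r //; lra.
have [z2|z2] := leP (-1) z; last by constructor 1; split=> //; lra.
by constructor 2; split=> //; apply/andP; split; lra.
Qed.

Lemma clip_le1 z : `|clip z| <= 1.
Proof. by rewrite ler_norml; apply/andP; case: (clip_cases z) => -[-> h]; split; lra. Qed.

Lemma clip_lipschitz z z' : `|clip z - clip z'| <= `|z - z'|.
Proof.
have h1 := ler_norm (z - z'); have h2 := lerNnormlW (lexx `|z - z'|).
rewrite ler_norml; apply/andP.
by case: (clip_cases z) => -[-> h]; case: (clip_cases z') => -[-> h']; split; lra.
Qed.

Lemma clipN z : clip (- z) = - clip z.
Proof. by case: (clip_cases z) => -[-> h]; case: (clip_cases (- z)) => -[-> h']; lra. Qed.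

Lemma clip_large z : 1 <= `|z| -> clip z ^+ 2 = 1.
Proof.
rewrite ler_normr => /orP z1; case: (clip_cases z) => -[-> h]; rewrite ?sqrrN ?expr1n //.
by case: z1 => ?; [have -> : z = 1 by lra | have -> : z = -1 by lra]; rewrite ?sqrrN expr1n.
Qed.

(** * Sign sums of random sets *)

Section SignSums.
Variable T : finType.
Implicit Types H N : {set T}.

Definition sign_sum H N : R := \sum_(j in N) sgb (j \in H).

Lemma sign_sum_change H N N' v : N :\ v = N' :\ v -> `|sign_sum H N - sign_sum H N'| <= 1.
Proof.
move=> eNN'.
have split M : sign_sum H M = (v \in M)%:R * sgb (v \in H) + sign_sum H (M :\ v).
  rewrite /sign_sum; case: (boolP (v \in M)) => vM; first by rewrite (big_setD1 v) //= mul1r.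
  by rewrite mul0r add0r; apply: eq_bigl => j; rewrite !inE;
    case: eqP => // ->; rewrite (negPf vM).
rewrite (split N) (split N') eNN'; set s := sign_sum _ _.
by rewrite ler_norml /sgb; case: (v \in N); case: (v \in N'); case: (v \in H);
  apply/andP; split; rewrite /=; lra.
Qed.

(** Symmetric difference with [N]: a bijection on the sets [H], hence a symmetry of the uniform
    distribution, that reverses exactly the signs on [N]. *)
Definition flip N H : {set T} := [set j | (j \in H) (+) (j \in N)].

Lemma flipK N : involutive (flip N).
Proof. by move=> H; apply/setP => j; rewrite !inE -addbA addbb addbF. Qed.

Lemma sign_sum_flip N H : sign_sum (flip N H) N = - sign_sum H N.
Proof.
rewrite /sign_sum -sumrN; apply: eq_bigr => j jN; rewrite inE jN addbT.
by case: (j \in H); rewrite /sgb //= opprK.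
Qed.

Lemma sign_sum_flip_disjoint N N' H : [disjoint N & N'] -> sign_sum (flip N H) N' = sign_sum H N'.
Proof.
move=> dis; apply: eq_bigr => j jN'; rewrite inE.
by rewrite (disjointFl dis jN') addbF.
Qed.

(** Flipping on [N] negates the first factor, as [clip] is odd, and fixes the second, so the sum
    equals its own negative. *)
Lemma clip_uncorrelated (a : R) N N' : [disjoint N & N'] ->
  \sum_H clip (sign_sum H N / a) * clip (sign_sum H N' / a) = 0.
Proof.
move=> dis; set S := (X in X = 0); suff : S = - S by move=> h; lra.
rewrite {1}/S (reindex_inj (inv_inj (flipK N))) /= /S -sumrN; apply: eq_bigr => H _.
by rewrite sign_sum_flip sign_sum_flip_disjoint // mulNr clipN mulNr.
Qed.

Lemma sign_sumE H N : sign_sum H N = 2 * #|H :&: N|%:R - #|N|%:R.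
Proof.
rewrite -[in X in _ - X](cardsID H N) natrD setIC.
rewrite /sign_sum (big_setID H) /=.
rewrite (eq_bigr (fun _ => 1)); last by move=> j /setIP[_ ->].
rewrite [X in _ + X = _](eq_bigr (fun _ => -1)); last by move=> j /setDP[_ /negPf ->].
by rewrite !sumr_const mulNrn; ring.
Qed.

(** A set is determined by its traces on [N] and on the complement of [N]. *)
Lemma card_inter_eq N k : (#|[set H : {set T} | #|H :&: N| == k]| <= 'C(#|N|, k) * 2 ^ (#|T| - #|N|))%N.
Proof.
have inj : injective (fun H : {set T} => (H :&: N, H :&: ~: N)).
  move=> H H' [e1 e2]; apply/setP => j; move/setP/(_ j): e1; move/setP/(_ j): e2.
  by rewrite !inE; case: (j \in N); rewrite ?andbT ?andbF.
rewrite -(card_imset _ inj) -cards_draws.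
have -> : (#|T| - #|N| = #|~: N|)%N by rewrite -(cardsC N) addKn.
rewrite -card_powerset -cardsX.
apply/subset_leq_card/subsetP => P /imsetP[H]; rewrite inE => Hk ->.
by rewrite !inE subsetIr /= Hk subsetIr.
Qed.

End SignSums.

(** * Central binomial coefficients and anticoncentration *)

Lemma leq_bin_incr n k : (k.*2 < n)%N -> ('C(n, k) <= 'C(n, k.+1))%N.
Proof.
move=> kn; rewrite -(leq_pmul2l (ltn0Sn k)) mul_bin_left leq_mul2r.
by apply/orP; right; lia.
Qed.

Lemma leq_bin_central M k : ('C(M.*2, k) <= 'C(M.*2, M))%N.
Proof.
have low j : (j <= M)%N -> ('C(M.*2, j) <= 'C(M.*2, M))%N.
  move=> jM; rewrite -(subKn jM); elim: (M - j)%N => [|d IH]; first by rewrite subn0.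
  (* Once [d] reaches [M], the truncated subtraction stays at 0 and there is nothing to prove. *)
  have [dM|Md] := ltnP d M; last by move: IH; rewrite (eqP Md) (eqP (leqW Md)).
  rewrite -(subnSK dM) in IH; apply: leq_trans IH; apply: leq_bin_incr; lia.
have [/low //|Mk] := leqP k M.
have [kM|/bin_small -> //] := leqP k M.*2.
by rewrite -bin_sub //; apply: low; lia.
Qed.

(** Squared to stay within the natural numbers. The induction uses [(M + 1) * C(2M + 2, M + 1) = 2 *
    (2M + 1) * C(2M, M)] and [(2M + 1) * (2M + 3) <= (2M + 2) ^ 2]. *)
Lemma central_bin_sqr M : ('C(M.*2, M) ^ 2 * M.*2.+1 <= (2 ^ M.*2) ^ 2)%N.
Proof.
elim: M => [//|M IH].
have rec : (M.+1 * 'C(M.+1.*2, M.+1) = 2 * M.*2.+1 * 'C(M.*2, M))%N.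
  have e1 : (M.*2.+2 * 'C(M.*2.+1, M) = M.+1 * 'C(M.*2.+2, M.+1))%N := mul_bin_diag _ _.
  have e2 : (M.*2.+1 * 'C(M.*2, M) = (M.*2.+1 - M) * 'C(M.*2.+1, M))%N := mul_bin_down _ _.
  by rewrite doubleS -e1 -mulnA e2 mulnA; congr (_ * _)%N; lia.
have -> : (2 ^ M.+1.*2 = 4 * 2 ^ M.*2)%N by rewrite doubleS !expnS mulnA.
rewrite -(leq_pmul2l (m := M.+1 ^ 2)) ?expn_gt0 //.
rewrite mulnA -expnMn rec.
move: IH; set c := 'C(_, _); set p := (2 ^ _)%N => IH.
have : (4 * M.*2.+1 * M.+1.*2.+1 * (c ^ 2 * M.*2.+1) <= 4 * M.*2.+1 * M.+1.*2.+1 * p ^ 2)%N.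
  by rewrite leq_mul2l IH orbT.
move=> h; apply: leq_trans (leq_trans _ _); [|exact: h|]; first by rewrite -!mulnn; lia.
rewrite expnMn mulnA leq_mul2r; apply/orP; right; nia.
Qed.

(** A sign sum below [a] in absolute value confines [#|H :&: N|] to a window of [2 * a] values
    around [#|N| / 2]. Each value has probability at most [1 / sqrt (400 * a ^ 2 + 1)], below
    [1 / (20 * a)], which makes 1/10 in total. *)
Lemma anticoncentration (T : finType) (N : {set T}) (a : nat) :
  (0 < a)%N -> #|N| = (400 * a ^ 2)%N ->
  (10 * #|[set H : {set T} | (`|sign_sum H N| < a%:R)%R]| <= 2 ^ #|T|)%N.
Proof.
move=> a0 cN; pose M := (200 * a ^ 2)%N.
have NM : #|N| = M.*2 by rewrite cN /M; lia.
have aM : (a <= M)%N by rewrite /M; nia.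
have sub : [set H : {set T} | `|sign_sum H N| < a%:R] \subset
   \bigcup_(k < a.*2) [set H : {set T} | #|H :&: N| == (M - a + k)%N].
  apply/subsetP => H; rewrite inE sign_sumE NM ltr_norml => /andP[].
  set h := #|_ :&: _|; rewrite ltrBrDr ltrBlDr -!natrM -natrD => h1 h2.
  have {}h2 : (2 * h < a + M.*2)%N by rewrite -(ltr_nat R) .
  have {}h1 : (M.*2 < 2 * h + a)%N by rewrite -(ltr_nat R) natrD; lra.
  have hk : (h - (M - a) < a.*2)%N by lia.
  by apply/bigcupP; exists (Ordinal hk) => //=; rewrite inE -/h; apply/eqP; lia.
have cent : ('C(M.*2, M) * (20 * a) <= 2 ^ M.*2)%N.
  rewrite -(@leq_exp2r _ _ 2) // expnMn; apply: leq_trans (central_bin_sqr M).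
  by rewrite leq_mul2l; apply/orP; right; rewrite /M; nia.
have card_sub : (#|[set H : {set T} | (`|sign_sum H N| < a%:R)%R]| <=
    a.*2 * ('C(M.*2, M) * 2 ^ (#|T| - M.*2)))%N.
  apply: leq_trans (subset_leq_card sub) _.
  apply: (@leq_trans (\sum_(k < a.*2) #|[set H : {set T} | #|H :&: N| == (M - a + k)%N]|)).
    elim/big_rec2: _ => [|k s B _ IH]; first by rewrite cards0.
    by apply: leq_trans (leq_card_setU _ _) _; rewrite leq_add2l.
  rewrite -[X in (X * _)%N](card_ord a.*2) -sum_nat_const; apply: leq_sum => k _.
  apply: leq_trans (card_inter_eq _ _) _; rewrite NM leq_mul2r leq_bin_central orbT //.
have leT : (M.*2 <= #|T|)%N by rewrite -NM max_card.
rewrite -(subnKC leT) expnD.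
apply: (@leq_trans (('C(M.*2, M) * (20 * a)) * 2 ^ (#|T| - M.*2))%N); last by rewrite leq_mul2r cent orbT.
rewrite -(subnKC leT) addKn in card_sub *; move: card_sub; set X := #|_|.
by move=> h; move: h; set c := 'C(_, _); set q := (2 ^ _)%N; nia.
Qed.

(** * The protocol on graphs *)

(** The accuracy bounds hold for every single graph of each family, so averaging only requires the
    family to be nonempty. *)
Lemma unif_avg_ge n (S : {set graph n}) (f : graph n -> R) (r : R) :
  S != set0 -> (forall G, G \in S -> r <= f G) -> r <= unif_avg S f.
Proof.
rewrite -card_gt0 => S0 hf; rewrite /unif_avg mulrC ler_pdivlMr ?ltr0n //.
by rewrite mulr_natr -sumr_const; apply: ler_sum.
Qed.

Lemma card_sets_ord n : #|{set 'I_n}| = (2 ^ n)%N.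
Proof. by rewrite -cardsT -powersetT card_powerset cardsT card_ord. Qed.

Section Graphs.
Variable n : nat.
Implicit Types (G : graph n) (H N T : {set 'I_n}).

Lemma node_neighborsP G G' : node_neighbors G G' ->
  exists v, forall i, i != v -> nbhd G i :\ v = nbhd G' i :\ v.
Proof.
case=> v hv; exists v => i iv; apply/setP => j; rewrite !inE; case: eqP => //= /eqP jv.
by apply: hv; rewrite !inE negb_or eq_sym iv eq_sym jv.
Qed.

Lemma node_neighbors_sym G G' : node_neighbors G G' -> node_neighbors G' G.
Proof. by case=> v hv; exists v => e ve; rewrite hv. Qed.

Lemma nbhd_starpartite T i : i \notin T -> nbhd (starpartite T) i = T.
Proof.
move=> iT; apply/setP => j; rewrite !inE; apply/idP/idP => [/existsP[k /andP[kT /existsP[l]]]|jT].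
  move=> /andP[_ /eqP e]; have : k \in [set i; j] by rewrite e set21.
  by rewrite !inE => /orP[]/eqP ek; [rewrite -ek kT in iT | rewrite -ek].
apply/existsP; exists j; rewrite jT; apply/existsP; exists i.
rewrite setUC eqxx andbT; by apply: contraNneq iT => ->.
Qed.

(** A node whose neighbourhood meets that of [i] is reached from [i] by two steps through a common
    neighbour, with [t] choices for each step. *)
Lemma card_meeting_nbhds G (t : nat) i : (forall j, #|nbhd G j| = t) ->
  (#|[set k | ~~ [disjoint nbhd G i & nbhd G k]]| <= t * t)%N.
Proof.
move=> reg.
have sub : [set k | ~~ [disjoint nbhd G i & nbhd G k]] \subset \bigcup_(j in nbhd G i) nbhd G j.
  apply/subsetP => k; rewrite inE -setI_eq0 => /set0Pn[j /setIP[ij kj]].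
  by apply/bigcupP; exists j => //; move: kj; rewrite !inE setUC.
apply: leq_trans (subset_leq_card sub) _; rewrite -{1}(reg i) -sum_nat_const.
apply: (@leq_trans (\sum_(j in nbhd G i) #|nbhd G j|)); last by apply: leq_sum => j _; rewrite reg.
elim/big_rec2: _ => [|k s B _ IH]; first by rewrite cards0.
by apply: leq_trans (leq_card_setU _ _) _; rewrite leq_add2l.
Qed.

Variables g a : R.

Definition node_bias H N : R := g * clip (sign_sum H N / a).

Definition node_pmf H (i : 'I_n) N : bool -> R := bit_pmf (node_bias H N).

Definition unif_pmf (H : {set 'I_n}) : R := (2 ^ n)%:R^-1.

(** The threshold on the absolute value of the sum is [5 * sqrt n], half of the shift expected for a
    starpartite graph. The square is compared because the sign of the shift depends on [H]. *)
Definition decide (y : {ffun 'I_n -> bool}) : answer :=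
  if 25 * n%:R <= (\sum_i sgb (y i)) ^+ 2 then Starpartite else Regular.

(** * Privacy of the published bits *)

Hypotheses (g_ge0 : 0 <= g) (g_le : g <= 1 / 2) (a_gt0 : 0 < a).

Lemma node_bias_le H N : `|node_bias H N| <= g.
Proof.
by rewrite /node_bias normrM ger0_norm // ler_piMr // clip_le1.
Qed.

Lemma node_bias_le1 H N : `|node_bias H N| <= 1.
Proof. by have := node_bias_le H N; have := g_le; lra. Qed.

Lemma is_pmf_unif : is_pmf unif_pmf.
Proof.
split=> [H|]; first by rewrite invr_ge0.
rewrite sumr_const card_sets_ord.
by rewrite -[LHS]mulr_natr mulVf // pnatr_eq0 expn_eq0.
Qed.

Lemma node_bias_change H N N' v : N :\ v = N' :\ v ->
  `|node_bias H N - node_bias H N'| <= g / a.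
Proof.
move=> e; rewrite /node_bias -mulrBr normrM ger0_norm // ler_wpM2l //.
apply: le_trans (clip_lipschitz _ _) _.
rewrite -mulrBl normrM (gtr0_norm (x := a^-1)) ?invr_gt0 // ler_piMl ?invr_ge0 ?(ltW a_gt0) //.
exact: sign_sum_change e.
Qed.

(** The rewired node shifts its bias by at most [2 * g], which gives [4 * g ^ 2]; every other node
    shifts by at most [g / a], which gives the summand with factor [n]. *)
Lemma node_pmf_indist (m : nat) (eps delta : R) H G G' :
  4 * m.+1%:R * g <= 1 ->
  expR (2 * m.+1%:R ^+ 2 * (n%:R * (g / a) ^+ 2 + 4 * g ^+ 2) - m%:R * eps) <= delta ->
  node_neighbors G G' -> forall Y : {set {ffun 'I_n -> bool}},
  \sum_(y in Y) out_pmf (node_pmf H) G y <=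
    expR eps * \sum_(y in Y) out_pmf (node_pmf H) G' y + delta.
Proof.
move=> hm hd /node_neighborsP[v hv].
have far i : `|node_bias H (nbhd G i) - node_bias H (nbhd G' i)| <= 2 * g.
  apply: le_trans (ler_normB _ _) _.
  by have := node_bias_le H (nbhd G i); have := node_bias_le H (nbhd G' i); lra.
apply: (@bits_indist _ (fun i => node_bias H (nbhd G i)) (fun i => node_bias H (nbhd G' i)) m).
- by move=> i; apply: le_trans (node_bias_le _ _) _.
- by move=> i; apply: le_trans (node_bias_le _ _) _.
- move=> i; apply: le_trans hm.
  rewrite (_ : 4 * m.+1%:R * g = 2 * m.+1%:R * (2 * g)); last by ring.
  by apply: ler_wpM2l; [rewrite mulr_ge0 | exact: far].
- apply: le_trans hd; rewrite ler_expR lerD2r; apply: ler_wpM2l; first by rewrite mulr_ge0 ?sqr_ge0.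
  rewrite (bigD1 v) //= addrC; apply: lerD; last first.
    rewrite -real_normK ?num_real // (_ : 4 * g ^+ 2 = (2 * g) ^+ 2); last by ring.
    by rewrite lerXn2r ?nnegrE // mulr_ge0.
  apply: (@le_trans _ _ (\sum_(i : 'I_n) (g / a) ^+ 2)); last by rewrite sumr_const card_ord mulr_natl.
  rewrite [leRHS](bigD1 v) //=; apply: ler_wpDl; first exact: sqr_ge0.
  apply: ler_sum => i iv; rewrite -real_normK ?num_real //.
  rewrite lerXn2r ?nnegrE //; first by rewrite divr_ge0 // ltW.
  exact: node_bias_change (hv _ iv).
Qed.

Lemma node_pmf_LNDP (m : nat) (eps delta : R) :
  4 * m.+1%:R * g <= 1 ->
  expR (2 * m.+1%:R ^+ 2 * (n%:R * (g / a) ^+ 2 + 4 * g ^+ 2) - m%:R * eps) <= delta ->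
  is_LNDP unif_pmf node_pmf eps delta.
Proof.
move=> hm hd; split; first exact: is_pmf_unif.
  by move=> H i N; apply/is_pmf_bit/node_bias_le1.
move=> H G G' _ _ nn Y; split; first exact: node_pmf_indist hm hd nn Y.
by apply: node_pmf_indist hm hd _ Y; exact: node_neighbors_sym.
Qed.

(** * Accuracy of the decision rule *)

Hypothesis n_gt0 : (0 < n)%N.
Hypothesis g_sqr : g ^+ 2 * n%:R = 100.

Let mean H G : R := \sum_i node_bias H (nbhd G i).

Lemma accept_ge H G (b : answer) (alpha beta : R) : 0 <= alpha -> 0 <= beta ->
  (forall y, decide y != b ->
    1 <= alpha * (\sum_i sgb (y i) - mean H G) ^+ 2 + beta) ->
  1 - (alpha * n%:R + beta) <= \sum_(y : {ffun 'I_n -> bool} | decide y == b) out_pmf (node_pmf H) G y.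
Proof.
move=> a0 b0 hy.
have le1 i := node_bias_le1 H (nbhd G i).
have := bits_tail le1 a0 b0 hy.
have := (prod_pmf (fun i => is_pmf_bit (le1 i))).2.
rewrite (bigID (fun y => decide y == b)) /= => e h.
by rewrite lerBlDr -[leLHS]e lerD2l; exact: h.
Qed.

(** All nodes outside [T] have the same clipped value, 1 or -1, and those in [T] cancel at most
    [#|T|] of it. What remains is at least [n - 2 * #|T| >= 3 / 4 * n], and
    [100 * 9 / 16 = 225 / 4]. *)
Lemma mean_sqr_starpartite H T : (8 * #|T| <= n)%N -> a <= `|sign_sum H T| ->
  225 / 4 * n%:R <= mean H (starpartite T) ^+ 2.
Proof.
move=> Tn large; set c := clip (sign_sum H T / a).
have c2 : c ^+ 2 = 1.
  by apply: clip_large; rewrite normrM normfV (gtr0_norm a_gt0) ler_pdivlMr // mul1r.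
pose e := \sum_(i in T) clip (sign_sum H (nbhd (starpartite T) i) / a).
have meanE : mean H (starpartite T) = g * (c * (n%:R - #|T|%:R) + e).
  rewrite /mean /node_bias -mulr_sumr; congr (_ * _).
  rewrite (bigID (mem T)) /= -/e [LHS]addrC; congr (_ + _).
  rewrite (eq_bigr (fun=> c)) => [|i iT]; last by rewrite nbhd_starpartite.
  rewrite sumr_const -[LHS]mulr_natr; congr (_ * _).
  have -> : #|[pred i | i \notin T]| = #|~: T| by apply: eq_card => i; rewrite !inE.
  have -> : n%:R = #|T|%:R + #|~: T|%:R :> R by rewrite -natrD cardsC card_ord.
  by rewrite addrC addKr.
have e_le : `|e| <= #|T|%:R.
  rewrite -sumr_const; apply: le_trans (ler_norm_sum _ _ _) _.
  by apply: ler_sum => i _; apply: clip_le1.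
have Tn' : 8 * #|T|%:R <= n%:R :> R by rewrite -natrM ler_nat.
have n0 : 0 < n%:R :> R by rewrite ltr0n.
set s := c * (n%:R - #|T|%:R) + e.
have s2 : (3 / 4 * n%:R) ^+ 2 <= s ^+ 2.
  rewrite -(real_normK (num_real s)) lerXn2r ?nnegrE //; first by rewrite mulr_ge0 // divr_ge0.
  have c1 : `|c| = 1.
    by move/eqP: c2; rewrite sqrf_eq1 => /orP[] /eqP ->; rewrite ?normrN normr1.
  apply: le_trans (lerB_normD _ _); rewrite normrM c1 mul1r ger0_norm; lra.
rewrite meanE -/s exprMn.
have : g ^+ 2 * (3 / 4 * n%:R) ^+ 2 <= g ^+ 2 * s ^+ 2 by rewrite ler_wpM2l // sqr_ge0.
rewrite (_ : g ^+ 2 * _ = g ^+ 2 * n%:R * (9 / 16 * n%:R)); last by field.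
by rewrite g_sqr; lra.
Qed.

Lemma starpartite_accept (k : nat) T : (0 < k)%N -> a = k%:R -> #|T| = (400 * k ^ 2)%N ->
  (8 * #|T| <= n)%N -> 2 / 3 <= alg_prob unif_pmf node_pmf decide (starpartite T) Starpartite.
Proof.
move=> k0 ak cT Tn; rewrite /alg_prob; have n0 : 0 < n%:R :> R by rewrite ltr0n.
have good H : 21 / 25 * (a <= `|sign_sum H T|)%R%:R <=
    \sum_(y | decide y == Starpartite) out_pmf (node_pmf H) (starpartite T) y.
  have [large|_] := leP a `|sign_sum H T|; last first.
    rewrite mulr0n mulr0; apply: sumr_ge0 => y _; apply: prodr_ge0 => i _.
    exact: (is_pmf_bit (node_bias_le1 _ _)).1.
  (* The mean is at least [7.5 * sqrt n] in absolute value, so a wrong answer needs a deviation of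
     at least [2.5 * sqrt n]; hence the factor [4 / (25 * n)] and the error 4/25. *)
  have := @accept_ge H (starpartite T) Starpartite (4 / (25 * n%:R)) 0.
  rewrite (_ : 4 / (25 * n%:R) * n%:R = 4 / 25); last by field; rewrite gt_eqF.
  move=> h; apply: le_trans (h _ _ _) => //; first by rewrite /=; lra.
    by rewrite divr_ge0 // mulr_ge0.
  move=> y; rewrite /decide; case: leP => // small _.
  have := mean_sqr_starpartite Tn large.
  set s := \sum_i _ in small *; set mu := mean _ _ => hmu.
  rewrite addr0 mulrAC ler_pdivlMr ?mulr_gt0 // mul1r.
  have := sqr_ge0 (2 * (s - mu) - s); move: small hmu; rewrite !expr2; nra.
apply: (@le_trans _ _ (\sum_H unif_pmf H * (21 / 25 * (a <= `|sign_sum H T|)%R%:R))); last first.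
  by apply: ler_sum => H _; rewrite ler_wpM2l // is_pmf_unif.1.
(* At least 9/10 of the sets [H] are good, and [9 / 10 * 21 / 25] exceeds 2/3. *)
have few := anticoncentration k0 cT; rewrite card_ord in few.
set B := [set H | _] in few.
have cB : (#|B| + \sum_H (a <= `|sign_sum H T|)%R = 2 ^ n)%N.
  rewrite -big_mkcond /= sum1_card -card_sets_ord.
  rewrite -(cardsC B); congr (_ + _)%N; apply: eq_card => H.
  by rewrite !inE -leNgt ak.
rewrite /unif_pmf -!mulr_sumr -natr_sum [leRHS]mulrC ler_pdivlMr ?ltr0n ?expn_gt0 //.
move: few; rewrite -cB -(ler_nat R) natrM natrD; set p := #|B|; set q := (\sum_H _)%N => h.
have : (0 : R) <= q%:R by []. lra.
Qed.

(** In the expanded square, pairs with disjoint neighbourhoods average to zero. At most [n * t ^ 2]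
    pairs remain, each at most [g ^ 2], and [g ^ 2 * n = 100]. *)
Lemma mean_sqr_regular G (t : nat) : (forall i, #|nbhd G i| = t) ->
  \sum_H unif_pmf H * mean H G ^+ 2 <= 100 * t%:R ^+ 2.
Proof.
move=> reg; rewrite /unif_pmf -mulr_sumr mulrC ler_pdivrMr ?ltr0n ?expn_gt0 //.
pose cl H i := clip (sign_sum H (nbhd G i) / a).
rewrite (eq_bigr (fun H => g ^+ 2 * \sum_i \sum_k cl H i * cl H k)) => [|H _]; last first.
  rewrite /mean /node_bias -mulr_sumr exprMn; congr (_ * _); rewrite expr2 mulr_suml.
  by apply: eq_bigr => i _; rewrite mulr_sumr.
rewrite -mulr_sumr exchange_big /=.
rewrite -g_sqr -[leRHS]mulrA -[leRHS]mulrA ler_wpM2l ?sqr_ge0 //.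
have -> : n%:R * (t%:R ^+ 2 * (2 ^ n)%:R) = \sum_(i < n) t%:R ^+ 2 * (2 ^ n)%:R :> R.
  by rewrite sumr_const card_ord mulr_natl.
apply: ler_sum => i _.
rewrite exchange_big /=.
apply: (@le_trans _ _ (\sum_(k in [set k | ~~ [disjoint nbhd G i & nbhd G k]]) (2 ^ n)%:R)).
  rewrite [leRHS]big_mkcond /=; apply: ler_sum => k _; rewrite inE.
  case: ifPn => [_|/negPn dis]; last by rewrite clip_uncorrelated.
  rewrite -card_sets_ord -sumr_const; apply: ler_sum => H _.
  apply: le_trans (ler_norm _) _; rewrite normrM.
  by rewrite mulr_ile1 ?clip_le1.
rewrite sumr_const -[leLHS]mulr_natr [leLHS]mulrC ler_wpM2r // -natrX ler_nat -mulnn.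
exact: card_meeting_nbhds.
Qed.

Lemma regular_accept G (t : nat) : (forall i, #|nbhd G i| = t) -> (100 * t ^ 2 <= n)%N ->
  2 / 3 <= alg_prob unif_pmf node_pmf decide G Regular.
Proof.
move=> reg tn; rewrite /alg_prob; have n0 : 0 < n%:R :> R by rewrite ltr0n.
have good H : 1 - (2 / 25 + 2 / (25 * n%:R) * mean H G ^+ 2) <=
    \sum_(y | decide y == Regular) out_pmf (node_pmf H) G y.
  have c0 : 0 <= 2 / (25 * n%:R) :> R by rewrite divr_ge0 // mulr_ge0.
  (* With sum [s] and mean [mu], [s ^ 2 <= 2 * (s - mu) ^ 2 + 2 * mu ^ 2], and a wrong answer has
     [s ^ 2 >= 25 * n]. The offset depends on [H] and is averaged afterwards; both error terms end
     up at most 2/25. *)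
  have := @accept_ge H G Regular (2 / (25 * n%:R)) (2 / (25 * n%:R) * mean H G ^+ 2).
  rewrite (_ : 2 / (25 * n%:R) * n%:R = 2 / 25); last by field; rewrite gt_eqF.
  apply=> //; first by rewrite mulr_ge0 // sqr_ge0.
  move=> y; rewrite /decide; case: leP => // large _.
  set s := \sum_i _ in large *; set mu := mean _ _.
  rewrite -mulrDr mulrAC ler_pdivlMr ?mulr_gt0 // mul1r.
  have := sqr_ge0 (s - 2 * mu); move: large; rewrite !expr2; nra.
apply: (@le_trans _ _ (\sum_H unif_pmf H * (1 - (2 / 25 + 2 / (25 * n%:R) * mean H G ^+ 2)))); last first.
  by apply: ler_sum => H _; rewrite ler_wpM2l // is_pmf_unif.1.
rewrite (eq_bigr (fun H => 23 / 25 * unif_pmf H - 2 / (25 * n%:R) * (unif_pmf H * mean H G ^+ 2))); last first.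
  by move=> H _; field; rewrite gt_eqF.
rewrite sumrB -mulr_sumr -[X in _ - X]mulr_sumr is_pmf_unif.2.
have : 2 / (25 * n%:R) * \sum_H unif_pmf H * mean H G ^+ 2 <= 2 / 25.
  rewrite mulrAC ler_pdivrMr ?mulr_gt0 //.
  have := mean_sqr_regular reg; move: tn; rewrite -(ler_nat R) natrM natrX; lra.
lra.
Qed.

End Graphs.

(** * Choice of the parameters *)

Lemma nat_above (x : R) : 0 <= x -> exists2 m : nat, (0 < m)%N & x <= m%:R <= x + 1.
Proof.
move=> x0; exists (Num.truncn x).+1 => //; have /andP[h1 h2] := truncn_itv x0.
by rewrite ltW //= -natr1 lerD2r.
Qed.

(** From [ln x <= x - 1]. With [eps < 1 / 2] it gives [ln (1 / delta) / eps >= 1], so powers of this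
    ratio can be compared. *)
Lemma ln_inv_ge (delta : R) : 0 < delta -> delta < 1 / 10 -> 1 / 2 <= ln (1 / delta).
Proof.
move=> d0 d1; rewrite [1 / delta]div1r lnV ?posrE //.
have h : ln (1 + (delta - 1)) <= delta - 1 by apply: le_ln1Dx; lra.
by rewrite addrC subrK in h; lra.
Qed.

Theorem theorem7p1 :
  exists C c : R, 0 < C /\ 0 < c /\
  forall eps delta : R, 0 < eps -> eps < 1 / 2 -> 0 < delta -> delta < 1 / 10 ->
  exists t : nat, (0 < t)%N /\ t%:R <= C * ln (1 / delta) ^+ 5 / eps ^+ 6 /\
  forall n : nat, c * ln (1 / delta) ^+ 10 / eps ^+ 10 <= n%:R ->
    regular_graphs n t != set0 ->
    exists (Pub O : finType) (mu : Pub -> R)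
           (Rz : Pub -> 'I_n -> {set 'I_n} -> O -> R)
           (Post : {ffun 'I_n -> O} -> answer),
      is_LNDP mu Rz eps delta /\
      unif_avg (star_graphs n t) (fun G => alg_prob mu Rz Post G Starpartite) >= 2 / 3 /\
      unif_avg (regular_graphs n t) (fun G => alg_prob mu Rz Post G Regular) >= 2 / 3.
Proof.
(* With [r = ln (1 / delta) / eps] and [k <= 200 * r], [t = 400 * k ^ 2] is at most
   [1.6 * 10 ^ 7 * r ^ 2], and [100 * t ^ 2] is at most [2.56 * 10 ^ 16 * r ^ 4]. *)
exists (2 * 10 ^+ 7), (10 ^+ 17); split; first by rewrite mulr_gt0 // exprn_gt0.
split; first by rewrite exprn_gt0.
move=> eps delta e0 e1 d0 d1.
have L_ge := ln_inv_ge d0 d1; set L := ln (1 / delta) in L_ge *.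
have deltaE : delta = expR (- L) by rewrite /L div1r lnV ?posrE // opprK lnK ?posrE.
pose r := L / eps.
have Lr : L = r * eps by rewrite /r divfK // gt_eqF.
have r_ge1 : 1 <= r by rewrite /r ler_pdivlMr //; lra.
have r0 : 0 < r by lra.
have r_ge0 := ltW r0.
have r160 : 0 <= 160 * r by lra.
have r_2 : 0 <= 2 * r by lra.
(* [k] is the clipping scale and [m] the moment order. As [m * eps >= 2 * L], one [L] yields [delta]
   and the other pays for the divergence, which has to stay below 1/2. *)
have [k k0 /andP[k_ge k_le]] := nat_above r160.
have [m _ /andP[m_ge m_le]] := nat_above r_2.
have k_le' : k%:R <= 200 * r by lra.
have r200 : 0 <= 200 * r by lra.
have k2_le : k%:R ^+ 2 <= 4 * 10 ^+ 4 * r ^+ 2 :> R.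
  rewrite (_ : 4 * 10 ^+ 4 * r ^+ 2 = (200 * r) ^+ 2); last by ring.
  by rewrite lerXn2r ?nnegrE.
have r_pow j : r ^+ j <= r ^+ j.+1 by rewrite exprS ler_peMl // exprn_ge0 // ltW.
pose t := (400 * k ^ 2)%N; exists t; split; first by rewrite muln_gt0 expn_gt0 k0.
split.
  rewrite (_ : 2 * 10 ^+ 7 * L ^+ 5 / eps ^+ 6 = 2 * 10 ^+ 7 * r ^+ 5 / eps); last first.
    by rewrite Lr; field; rewrite gt_eqF.
  rewrite ler_pdivlMr // /t natrM natrX.
  have := r_pow 2%N; have := r_pow 3%N; have := r_pow 4%N.
  have : 0 <= (k%:R : R) ^+ 2 by rewrite sqr_ge0.
  set s := (k%:R : R) ^+ 2 in k2_le *; set r2 := r ^+ 2 in k2_le *; set r5 := r ^+ 5.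
  move=> s0 h4 h3 h2; have : 400 * s * eps <= 400 * s * 1 by rewrite ler_wpM2l ?mulr_ge0 //; lra.
  lra.
move=> n hn reg0.
have n_ge : 10 ^+ 17 * r ^+ 4 <= n%:R.
  apply: le_trans hn; rewrite -mulrA -expr_div_n -/r ler_pM2l ?exprn_gt0 //.
  by rewrite ler_weXn2l.
have r2_ge1 : 1 <= r ^+ 2 by rewrite exprn_ege1.
have r4E : r ^+ 4 = r ^+ 2 * r ^+ 2 by rewrite -exprD.
have n_ge2 : 10 ^+ 17 * r ^+ 2 <= n%:R.
  by apply: le_trans n_ge; rewrite ler_pM2l ?exprn_gt0 // r4E ler_peMl // ltW // exprn_gt0.
have n0 : 0 < n%:R :> R by apply: lt_le_trans n_ge2; rewrite mulr_gt0 ?exprn_gt0.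
pose g : R := 10 / Num.sqrt n%:R.
have sn0 : 0 < Num.sqrt n%:R :> R by rewrite sqrtr_gt0.
have g0 : 0 < g by rewrite divr_gt0.
have g_ge0 := ltW g0.
have g_sqr : g ^+ 2 * n%:R = 100.
  by rewrite /g expr_div_n sqr_sqrtr ?ler0n // divfK ?gt_eqF //; ring.
have gr_le : 160 * r * g <= 1.
  rewrite -(@expr_le1 _ 2) //; last exact: mulr_ge0.
  rewrite -(ler_pM2r n0) (_ : _ * n%:R = 160 ^+ 2 * r ^+ 2 * (g ^+ 2 * n%:R)); last by ring.
  rewrite g_sqr; lra.
have g_half : g <= 1 / 2 by nra.
have a0 : 0 < k%:R :> R by rewrite ltr0n.
exists {set 'I_n}, bool, (@unif_pmf n), (@node_pmf n g k%:R), (@decide n).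
have n_gt0 : (0 < n)%N by rewrite -(ltr_nat R).
have t_le : (100 * t ^ 2 <= n)%N.
  rewrite -(ler_nat R) natrM natrX /t natrM natrX; apply: le_trans n_ge; rewrite r4E.
  have : 0 <= (k%:R : R) ^+ 2 by rewrite sqr_ge0.
  move: k2_le r2_ge1; set s := (k%:R : R) ^+ 2; set r2 := r ^+ 2 => h1 h2 s0.
  have : s * s <= (4 * 10 ^+ 4 * r2) * (4 * 10 ^+ 4 * r2) by rewrite ler_pM.
  rewrite expr2; nra.
have t_gt0 : (0 < t)%N by rewrite /t muln_gt0 expn_gt0 k0.
have t8 : (8 * t <= n)%N by apply: leq_trans t_le; rewrite -mulnn leq_mul // leq_pmull.
have m1 : m.+1%:R <= 4 * r by rewrite -[m.+1%:R]natr1; lra.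
split.
  have rg : 0 <= r * g by rewrite mulr_ge0.
  have m1g : m.+1%:R * g <= 4 * r * g by rewrite ler_wpM2r.
  have hm : 4 * m.+1%:R * g <= 1 by lra.
  apply: (node_pmf_LNDP g_ge0 g_half a0 hm).
  rewrite deltaE ler_expR.
  set D := n%:R * _ + _.
  have D_ge0 : 0 <= D by apply: addr_ge0; apply: mulr_ge0 => //; exact: sqr_ge0.
  (* The factor 32 is [2 * 16], from [m.+1 <= 4 * r]. The other nodes contribute at most
     [3200 / 160 ^ 2 = 1 / 8], the rewired node at most 1/200. *)
  have D_le : D * (32 * r ^+ 2) <= 1 / 4.
    have -> : D = g ^+ 2 * n%:R / k%:R ^+ 2 + 4 * g ^+ 2.
      by rewrite /D expr_div_n mulrA [n%:R * _]mulrC.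
    rewrite g_sqr mulrDl.
    have h1 : 100 / k%:R ^+ 2 * (32 * r ^+ 2) <= 1 / 8.
      rewrite mulrAC ler_pdivrMr ?exprn_gt0 //.
      have : (160 * r) ^+ 2 <= k%:R ^+ 2 by rewrite lerXn2r ?nnegrE.
      by rewrite exprMn; lra.
    have h2 : (160 * r * g) ^+ 2 <= 1 by rewrite exprn_ile1 // mulr_ge0.
    have -> : 4 * g ^+ 2 * (32 * r ^+ 2) = (160 * r * g) ^+ 2 / 200 by field.
    lra.
  have m1_sqr : m.+1%:R ^+ 2 <= 16 * r ^+ 2.
    rewrite (_ : 16 * r ^+ 2 = (4 * r) ^+ 2); last by ring.
    by rewrite lerXn2r ?nnegrE //; apply: mulr_ge0.
  have : m.+1%:R ^+ 2 * D <= 16 * r ^+ 2 * D by rewrite ler_wpM2r.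
  have : 2 * r * eps <= m%:R * eps by rewrite ler_pM2r.
  by rewrite Lr; rewrite Lr in L_ge; lra.
split.
  apply: unif_avg_ge.
    (* Some set of [t] nodes exists because [t <= n], so the starpartite family is nonempty. *)
    have : (0 < #|[set T : {set 'I_n} | T \subset [set: 'I_n] & #|T| == t]|)%N.
      by rewrite cards_draws cardsT card_ord bin_gt0; apply: leq_trans t8; exact: leq_pmull.
    rewrite card_gt0 => /set0Pn[T]; rewrite inE => /andP[_ cT].
    by apply/set0Pn; exists (starpartite T); apply/imsetP; exists T; rewrite ?inE.
  move=> G /imsetP[T]; rewrite inE => /eqP cT ->.
  by apply: (starpartite_accept g_ge0 g_half a0 n_gt0 g_sqr k0); rewrite ?cT.
apply: unif_avg_ge => // G; rewrite inE => /andP[_ /forallP reg].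
by apply: (regular_accept k%:R g_ge0 g_half n_gt0 g_sqr (t := t)) => // i; exact/eqP.
Qed.
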